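(* Let $n\ge 1$ and $A \in \mathrm{SL}(n,\mathbb{C})$. Then $A$ is $c$-reversible if and only if $A$ is strongly $c$-reversible.
   Context: For $g\in\mathrm{SL}(n,\mathbb{C})$, $\overline{g}$ denotes the entrywise complex conjugate matrix. An element $g \in \mathrm{SL}(n,\mathbb{C})$ is called $c$-reversible if there exists $h\in\mathrm{SL}(n,\mathbb{C})$ with $hgh^{-1}=\overline{g}^{-1}$. If moreover such an $h$ can be chosen with $h\overline{h}=I$, then $g$ is called strongly $c$-reversible (and such $h$ is called an involutory $c$-symmetry). *)

(* Defs.v *)
From HB Require Import structures.
From mathcomp Require Import all_boot all_order all_algebra.
From mathcomp Require Import reals.
From mathcomp.real_closed Require Import complex.
Set Implicit Arguments. Unset Strict Implicit. Unset Printing Implicit Defensive.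
Import Order.TTheory GRing.Theory Num.Theory.
Local Open Scope ring_scope.

Definition inSL (R : realType) (n : nat) (g : 'M[R[i]]_n) : Prop := \det g = 1.

Definition mconj (R : realType) (n : nat) (g : 'M[R[i]]_n) : 'M[R[i]]_n :=
  map_mx (@conjc R) g.

Definition c_reversible (R : realType) (n : nat) (g : 'M[R[i]]_n) : Prop :=
  exists h : 'M[R[i]]_n, inSL h /\ h *m g *m invmx h = invmx (mconj g).

Definition strongly_c_reversible (R : realType) (n : nat) (g : 'M[R[i]]_n) : Prop :=
  exists h : 'M[R[i]]_n, [/\ inSL h, h *m g *m invmx h = invmx (mconj g)
                           & h *m mconj h = 1%:M].

(* Main.v *)
Require Import Defs.
From HB Require Import structures.
From mathcomp Require Import all_boot all_order all_algebra.
From mathcomp Require Import reals ring.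
From mathcomp.real_closed Require Import complex.
Local Open Scope ring_scope.
Import Order.TTheory GRing.Theory Num.Theory.

(** If h A h^-1 is the inverse of the conjugate of A, choose a on the unit
    circle outside the spectrum of A. The Cayley transform
    X = i (A + a) (A - a)^-1 turns the relation into h X h^-1 = conj X, so
    rank p(X) = rank (conj p)(X) for every polynomial p. This rank condition
    makes the minimal polynomial of X real, and it passes to a complement of a
    cyclic subspace of maximal dimension; by induction X is similar to a real
    matrix, say X = S^-1 Z S. Then K = (conj S)^-1 S satisfies K (conj K) = 1 and
    K X = (conj X) K, and transforming back, K conjugates A to the inverse of
    its conjugate. A unimodular scalar factor makes det K equal to 1. *)

(** * Cyclic vectors and stable complements *)

(** Every proper divisor of the minimal polynomial q divides q / (X - z) for some root z of q. Hence
    it suffices that v avoids the kernels of finitely many nonzero matrices. *)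
Lemma exists_cyclic_vector (F : closedFieldType) (n : nat) (A : 'M[F]_n.+1) :
  exists v : 'rV[F]_n.+1,
    forall p, v *m horner_mx A p = 0 -> mxminpoly A %| p.
Proof.
set q := mxminpoly A.
have q_neq0 : q != 0 by rewrite monic_neq0 ?mxminpoly_monic.
pose M z := horner_mx A (q %/ ('X - z%:P)).
(* The moment curve leaves every proper subspace, so a generic point of it is
   killed by none of the matrices M z. *)
pose w (t : F) : 'rV[F]_n.+1 := \row_i t ^+ i.
have wP z : root q z ->
    exists2 P : {poly F}, P != 0 & forall t, ~~ root P t -> w t *m M z != 0.
  move=> qz; have Mz_neq0 : M z != 0.
    have /dvdpP[q' qE] : 'X - z%:P %| q by rewrite dvdp_XsubCl.
    have q'_neq0 : q' != 0 by apply: contraNneq q_neq0 => q'0; rewrite qE q'0 mul0r.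
    rewrite /M -dvd_mxminpoly -/q {2}qE mulpK ?polyXsubC_eq0 //.
    apply/negP => /dvdp_leq-/(_ q'_neq0).
    by rewrite {1}qE size_Mmonic ?monicXsubC // size_XsubC addn2 ltnn.
  have /matrix0Pn[i [j Mij]] := Mz_neq0.
  (* A nonzero column of [M z], read as coefficients: its value at t is entry j of [w t *m M z]. *)
  exists (\poly_(k < n.+1) M z (inord k) j).
    apply/eqP => /(congr1 (fun p : {poly F} => p`_i)).
    by rewrite coef_poly ltn_ord inord_val coef0 => /eqP; rewrite (negPf Mij).
  move=> t; apply: contraNneq => wM0; rewrite /root horner_poly.
  have := congr1 (fun u : 'rV_n.+1 => u 0 j) wM0; rewrite !mxE => s0.
  apply/eqP; rewrite -[RHS]s0; apply: eq_bigr => k _.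
  by rewrite !mxE inord_val mulrC.
have wsP s : all (root q) s -> exists2 P : {poly F}, P != 0 &
    forall t, ~~ root P t -> all (fun z => w t *m M z != 0) s.
  elim: s => [_|z s IHs /= /andP[/wP[P P0 PP] /IHs[Q Q0 QQ]]].
    by exists 1; rewrite ?oner_eq0.
  exists (P * Q) => [|t]; first by rewrite mulf_neq0.
  by rewrite rootM negb_or => /andP[/PP-> /QQ->].
have [r rE] := closed_field_poly_normal q.
have lq_neq0 : lead_coef q != 0 by rewrite lead_coef_eq0.
have rP z : (z \in r) = root q z by rewrite rE rootZ // root_prod_XsubC.
have [|P P_neq0 PP] := wsP r; first by apply/allP => z; rewrite rP.
have [t /PP/allP tP] := closed_nonrootP _ P_neq0.
exists (w t) => p wp0.
(* By Bezout, the gcd g of p and q also kills [w t]. If q / g had a root z, then g would divide q /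
   (X - z), against the choice of t. *)
have [[u1 u2] /= /eqpP[[c1 c2] /= /andP[c1_neq0 c2_neq0] gE]] := Bezoutp p q.
set g := gcdp p q in gE.
have wg0 : w t *m horner_mx A g = 0.
  apply: (scalerI c2_neq0); rewrite scaler0 scalemxAr -linearZ /= -gE linearZ /=.
  rewrite !rmorphD !rmorphM /= mx_root_minpoly mulr0 addr0.
  by rewrite comm_horner_mx2 -scalemxAr mulmxA wp0 mul0mx scaler0.
have [e qE] := dvdpP _ _ (dvdp_gcdr p q); rewrite -/g in qE.
have [/eqP/size_poly1P[c c0 eE]|/closed_rootP[z ez]] := eqVneq (size e) 1.
  apply: dvdp_trans (dvdp_gcdl p q); rewrite -/g -/q qE eE mul_polyC.
  by rewrite dvdpZl.
have qz : root q z by rewrite qE rootM ez.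
have := tP z; rewrite rP => /(_ qz) /negP[]; rewrite /M.
move: ez; rewrite root_factor_theorem => /dvdpP[e' eE].
rewrite qE eE mulrAC mulpK ?polyXsubC_eq0 //.
by rewrite rmorphM /= comm_horner_mx2 mulmxA wg0 mul0mx.
Qed.

(** The rows of [V] are v, vA, ..., vA^(d-1) for a cyclic vector v. [W] spans the largest stable
    subspace killed by a functional dual to vA^(d-1). *)
Lemma cyclic_splitting (F : closedFieldType) (n : nat) (A : 'M[F]_n.+1)
    (q := mxminpoly A) (d := (size q).-1) :
  exists (r : nat) (V : 'M[F]_(d, n.+1)) (W : 'M[F]_(r, n.+1)) (Y : 'M[F]_r),
    [/\ row_free (col_mx V W), row_full (col_mx V W),
        V *m A = companionmx q *m V & W *m A = Y *m W].
Proof.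
have [v vP] := exists_cyclic_vector F n A; rewrite -/q in vP.
have q_monic : q \is monic := mxminpoly_monic A.
have sq : size q = d.+1 by rewrite /d /q size_mxminpoly.
have d_gt0 : (0 < d)%N by rewrite /d /q size_mxminpoly mxminpoly_nonconstant.
pose V : 'M[F]_(d, n.+1) := \matrix_(i < d) (v *m horner_mx A 'X^i).
have VE (u : 'rV_d) : u *m V = v *m horner_mx A (rVpoly u).
  rewrite mulmx_sum_row /rVpoly poly_def rmorph_sum mulmx_sumr.
  by apply: eq_bigr => i _; rewrite rowK valK /= linearZ -scalemxAr.
have hornerMA (w : 'rV_n.+1) p1 p2 :
    w *m horner_mx A p1 *m horner_mx A p2 = w *m horner_mx A (p1 * p2).
  by rewrite rmorphM /= mulmxA.
have Vfree : row_free V.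
  apply: inj_row_free => u; rewrite VE => /vP qu.
  apply: (can_inj rVpolyK); rewrite linear0; apply/eqP; apply: contraTT qu => u0.
  by apply/negP => /(dvdp_leq u0); rewrite sq ltnNge size_poly.
have VA : V *m A = companionmx q *m V.
  apply/row_matrixP => i; rewrite !row_mul VE rowK -mulmxA.
  (* Row i of the companion matrix is X^(i+1) modulo q; only the last row needs the reduction. *)
  have -> : rVpoly (row i (companionmx q)) = 'X^(i.+1) - q *+ (i == d.-1 :> nat).
    apply/polyP => k; rewrite coefB coefMn coefXn.
    have [k_lt|k_ge] := ltnP k d.
      rewrite (coef_rVpoly_ord _ (Ordinal k_lt)) !mxE /= [k == _]eq_sym.
      have [->|] := eqVneq (i : nat) d.-1; last by rewrite mulr0n subr0.
      by rewrite prednK // gtn_eqF // sub0r.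
    rewrite coef_rVpoly insubF ?ltnNge ?k_ge //.
    have [->|ni] := eqVneq (i : nat) d.-1; last first.
      rewrite mulr0n subr0 gtn_eqF // (leq_trans _ k_ge) // ltn_neqAle ltn_ord andbT.
      by apply: contraNneq ni => /(congr1 predn) /= ->.
    rewrite prednK // mulr1n; have [->|kd] := eqVneq k d.
      by move: (monicP q_monic); rewrite /lead_coef sq => ->; rewrite subrr.
    by rewrite nth_default ?subr0 // sq ltn_neqAle eq_sym kd.
  rewrite rmorphB rmorphMn /= mx_root_minpoly mul0rn subr0 exprSr rmorphM /=.
  by rewrite horner_mx_X.
have ltd1 : (d.-1 < d)%N by rewrite prednK.
(* phi is 1 on v A^(d-1) and 0 on v A^i for i < d - 1, so the Hankel matrix
   V *m H is invertible, and kermx H is an invariant complement of V. *)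
pose phi : 'cV[F]_n.+1 := pinvmx V *m delta_mx (Ordinal ltd1) 0.
have phiE (g : {poly F}) : (size g <= d)%N -> (v *m horner_mx A g *m phi) 0 0 = g`_d.-1.
  move=> sg; rewrite -(poly_rV_K sg) -VE /phi mulmxA mulmxKp //.
  by rewrite -colE !mxE (poly_rV_K sg).
pose H : 'M[F]_(n.+1, d) := \matrix_(i, j) (horner_mx A 'X^j *m phi) i 0.
have HE (w : 'rV_n.+1) j : (w *m H) 0 j = (w *m horner_mx A 'X^j *m phi) 0 0.
  by rewrite -mulmxA !mxE; apply: eq_bigr => k _; rewrite mxE.
(* Reducing p modulo q leaves only the powers below d, which are the columns of [H]. *)
have HP (w : 'rV_n.+1) p : w *m H = 0 -> (w *m horner_mx A p *m phi) 0 0 = 0.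
  move=> wH; rewrite (Pdiv.IdomainMonic.divp_eq q_monic p).
  rewrite rmorphD rmorphM /= mx_root_minpoly mulr0 add0r.
  have sp : (size (p %% q)%R <= d)%N by rewrite -ltnS -sq ltn_modp monic_neq0.
  rewrite -(poly_rV_K sp) /rVpoly poly_def rmorph_sum mulmx_sumr mulmx_suml summxE.
  apply: big1 => i _. Show. rewrite /= horner_mxZ -scalemxAr -scalemxAl mxE -HE wH.
  by rewrite mxE mulr0.
have VHfree : row_free (V *m H).
  apply: inj_row_free => u; rewrite mulmxA VE => uH.
  apply: (can_inj rVpolyK); rewrite linear0; set f := rVpoly u.
  apply/eqP; apply: contraT => f_neq0.
  have sf : (size f <= d)%N by apply: size_poly.
  (* The shift moves the leading coefficient of f to degree d - 1, where [phi] reads it. *)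
  have sfX : size (f * 'X^(d - size f)) = d.
    by rewrite size_mulXn // subnK.
  have := HP _ 'X^(d - size f) uH; rewrite hornerMA phiE ?sfX //.
  have := lead_coefE (f * 'X^(d - size f)); rewrite sfX => <- /eqP.
  by rewrite lead_coef_Mmonic ?monicXn // lead_coef_eq0 (negPf f_neq0).
pose W := row_base (kermx H).
have Wstable : stablemx W A.
  rewrite stablemx_row_base; apply/sub_kermxP/row_matrixP => i.
  rewrite row0 2!(row_mul i); apply/rowP => j; rewrite HE [RHS]mxE.
  have -> (w : 'rV_n.+1) p : w *m A *m horner_mx A p = w *m horner_mx A ('X * p).
    by rewrite -hornerMA horner_mx_X.
  apply: HP.
  by apply/sub_kermxP; exact: row_sub.
have rankVH : \rank (V *m H) = d by apply/eqP.
have rankH : \rank H = d.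
  by apply/eqP; rewrite eqn_leq rank_leq_col -{1}rankVH mxrankM_maxr.
have VW0 : (V :&: W)%MS = 0.
  have := mxrank_mul_ker V H; rewrite rankVH (eqP Vfree) -[RHS]addn0 => /addnI.
  move/eqP; rewrite mxrank_eq0 => /eqP VH0; apply/eqP; rewrite -submx0 -VH0.
  by rewrite capmxS // eq_row_base.
have rankVW : \rank (col_mx V W) = n.+1.
  rewrite -addsmxE mxrank_disjoint_sum // (eqP Vfree) eq_row_base mxrank_ker rankH.
  by rewrite subnKC // -rankH rank_leq_row.
exists (\rank (kermx H)), V, W, (W *m A *m pinvmx W); split=> //.
- rewrite /row_free rankVW mxrank_ker rankH subnKC //.
  by rewrite -rankH rank_leq_row.
- by rewrite /row_full rankVW.
- by rewrite mulmxKpV.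
Qed.

(** * Similarity to a matrix fixed by a field endomorphism *)

Lemma horner_mx_intertwine (F : fieldType) (m n : nat)
    (B : 'M[F]_(m.+1, n.+1)) (Y : 'M[F]_m.+1) (X : 'M[F]_n.+1) (p : {poly F}) :
  B *m X = Y *m B -> B *m horner_mx X p = horner_mx Y p *m B.
Proof.
move=> BX; elim/poly_ind: p => [|p c IHp]; first by rewrite !rmorph0 mulmx0 mul0mx.
rewrite !rmorphD !rmorphM /= !horner_mx_X !horner_mx_C mulmxDr mulmxDl.
by rewrite mulmxA IHp -mulmxA BX mulmxA scalar_mxC.
Qed.

(** [P] is p(C), built by Horner's scheme so that d need not be a successor. It shows that p and its
    image under s have equal rank on [V]. *)
Lemma map_horner_mx_intertwine (F : fieldType) (s : {rmorphism F -> F})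
    (d n : nat) (V : 'M[F]_(d, n.+1)) (C : 'M[F]_d) (X : 'M[F]_n.+1) (p : {poly F}) :
    map_mx s C = C -> V *m X = C *m V ->
  exists P : 'M[F]_d, V *m horner_mx X p = P *m V /\
    V *m horner_mx X (map_poly s p) = map_mx s P *m V.
Proof.
move=> sC VX; elim/poly_ind: p => [|p c [P [IH1 IH2]]].
  by exists 0; rewrite map_mx0 map_poly0 !rmorph0 mulmx0 mul0mx.
exists (P *m C + c%:M).
rewrite map_mxD map_mxM sC map_scalar_mx.
rewrite !rmorphD !rmorphM /= map_polyX map_polyC !horner_mx_X !horner_mx_C.
by rewrite !mulmxDr !mulmxDl !mulmxA IH1 IH2 -!mulmxA VX !scalar_mxC.
Qed.

(** Induction on the size: the companion block is fixed by s because q is, and cancelling its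
    contribution to the ranks leaves the hypothesis for the complement. *)
Lemma similar_to_fixed (F : closedFieldType) (s : {rmorphism F -> F})
    (n : nat) (X : 'M[F]_n.+1) :
    (forall p, \rank (horner_mx X p) = \rank (horner_mx X (map_poly s p))) ->
  exists (m : nat) (B : 'M[F]_(m, n.+1)) (Z : 'M[F]_m),
    [/\ row_free B, row_full B, map_mx s Z = Z & B *m X = Z *m B].
Proof.
elim/ltn_ind: n X => n IHn X rankX.
set q := mxminpoly X.
have q_monic : q \is monic := mxminpoly_monic X.
(* The rank condition at q makes the image of q annihilate X; so q divides it, and both are monic of
   the same degree. *)
have sq : map_poly s q = q.
  apply/eqP; rewrite eq_sym -eqp_monic ?map_monic // -dvdp_size_eqp.
    by rewrite size_map_poly.
  by rewrite dvd_mxminpoly -mxrank_eq0 -rankX mx_root_minpoly mxrank0.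
have sqE k : s q`_k = q`_k by rewrite -[in RHS]sq coef_map.
have [r [V [W [Y [free full VX WX]]]]] := cyclic_splitting F n X.
rewrite -/q in V VX free full.
set C := companionmx q in VX.
have sC : map_mx s C = C.
  apply/matrixP => i j; rewrite !mxE; case: ifP => _; last by rewrite rmorph_nat.
  by rewrite rmorphN sqE.
have rVW : ((size q).-1 + r)%N = n.+1.
  by rewrite -(eqP full); apply/esym/eqP.
have r_le : (r <= n)%N.
  move: rVW; rewrite size_mxminpoly /= -[degree_mxminpoly X]prednK.
    by rewrite addSn => -[<-]; rewrite leq_addl.
  exact: mxminpoly_nonconstant.
have rV : \rank V = (size q).-1 /\ \rank W = r.
  have := mxrank_adds_leqif V W; rewrite addsmxE (eqP free) => -[le _].
  have lV := rank_leq_row V; have lW := rank_leq_row W.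
  split; apply/eqP; rewrite eqn_leq ?lV ?lW /=.
    by rewrite -(leq_add2r r) (leq_trans le) // leq_add2l.
  by rewrite -(leq_add2l (size q).-1) (leq_trans le) // leq_add2r.
have [rankV rankW] := rV.
have Wfree : row_free W by apply/eqP.
have VW0 : (V :&: W)%MS = 0.
  apply/eqP; rewrite -submx0 -(mxrank_adds_leqif V W) addsmxE (eqP free).
  by rewrite rankV rankW.
have [m [B [Z [Bfree Bfull sZ BY]]]] : exists m (B : 'M[F]_(m, r)) (Z : 'M[F]_m),
    [/\ row_free B, row_full B, map_mx s Z = Z & B *m Y = Z *m B].
  (* An empty complement ends the recursion. *)
  case: r W Y free full WX rVW r_le rV rankW Wfree VW0
    => [|r] W Y free full WX rVW r_le rV rankW Wfree VW0.
    exists 0%N, 1%:M, Y; split; rewrite ?row_free_unit ?row_full_unit ?unitmx1 //.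
      by apply/matrixP; case.
    by rewrite mul1mx mulmx1.
  apply: IHn => // p.
  (* g(X) maps [V] and [W] into themselves, so the rank is additive. *)
  have rank_split g : \rank (horner_mx X g) = (\rank (V *m horner_mx X g)
      + \rank (horner_mx Y g))%N.
    rewrite -(mxrankMfree (horner_mx Y g) Wfree) -(horner_mx_intertwine _ _ _ _ _ _ _ WX).
    rewrite -(eqmxMfull (horner_mx X g) full) mul_col_mx -addsmxE.
    rewrite mxrank_disjoint_sum //; apply/eqP; rewrite -submx0 -VW0.
    apply: capmxS; last by rewrite (horner_mx_intertwine _ _ _ _ _ _ _ WX) submxMl.
    have [P [-> _]] := map_horner_mx_intertwine _ _ _ _ _ _ _ g sC VX.
    exact: submxMl.
  have := rankX p; rewrite !rank_split.
  have [P [-> ->]] := map_horner_mx_intertwine _ _ _ _ _ _ _ p sC VX.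
  have Vfree : row_free V by apply/eqP.
  by rewrite !mxrankMfree // mxrank_map => /addnI.
have mr : m = r by rewrite -(eqP Bfree); apply/eqP.
have rankB : \rank (col_mx V (B *m W)) = n.+1.
  rewrite -addsmxE (adds_eqmx (eqmx_refl V) (eqmxMfull W Bfull)) addsmxE.
  exact/eqP.
exists ((size q).-1 + m)%N, (col_mx V (B *m W)), (block_mx C 0 0 Z); split.
- by rewrite /row_free rankB mr rVW.
- by rewrite /row_full rankB.
- by rewrite map_block_mx !map_mx0 sC sZ.
- rewrite mul_block_col !mul_col_mx !mul0mx addr0 add0r VX.
  by rewrite -mulmxA WX !mulmxA BY.
Qed.

(** With L the inverse of B, take K = s(L) B. Then K s(K) = s(L B) = 1, and X L = L Z with Z fixed
    gives K X = s(X) K. *)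
Lemma coninvolution_of_fixed (F : fieldType) (s : {rmorphism F -> F})
    (m n : nat) (B : 'M[F]_(m, n)) (Z : 'M[F]_m) (X : 'M[F]_n) :
    involutive s -> row_free B -> row_full B -> map_mx s Z = Z ->
    B *m X = Z *m B ->
  exists K : 'M[F]_n, K *m map_mx s K = 1%:M /\ K *m X = map_mx s X *m K.
Proof.
move=> sK /row_freeP[L BL] /row_fullP[L' L'B] sZ BX.
have LB : L *m B = 1%:M by rewrite -(mul1mx L) -L'B -(mulmxA L' B) BL mulmx1.
have XL : X *m L = L *m Z.
  by rewrite -(mul1mx (X *m L)) -LB -mulmxA (mulmxA B) BX -mulmxA BL mulmx1.
have ssB : map_mx s (map_mx s B) = B by apply/matrixP => i j; rewrite !mxE sK.
have ssL : map_mx s (map_mx s L) = L by apply/matrixP => i j; rewrite !mxE sK.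
exists (map_mx s L *m B); split.
  rewrite map_mxM ssL -mulmxA (mulmxA B) BL mul1mx -map_mxM LB.
  exact: map_mx1.
by rewrite mulmxA -map_mxM XL map_mxM sZ -!mulmxA BX.
Qed.

(** * The Cayley transform *)

(** Multiplying h X - s(X) h by the invertible s(D) and D gives 2j (s(A) h A - h): s(j) = -j turns
    the difference into a sum whose cross terms cancel, and s(a) a = 1. *)
Lemma cayley_intertwine (F : fieldType) (s : {rmorphism F -> F}) (n : nat)
    (A h : 'M[F]_n) (a j : F) (X := j *: ((A + a%:M) *m invmx (A - a%:M))) :
    2 != 0 :> F -> j != 0 -> s j = - j -> s a * a = 1 ->
    A - a%:M \in unitmx ->
  map_mx s A *m h *m A = h <-> h *m X = map_mx s X *m h.
Proof.
move=> two_neq0 j_neq0 sj saa Dunit.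
pose D := A - a%:M; pose N := A + a%:M; rewrite -/D in Dunit.
pose A' := map_mx s A; pose D' := map_mx s D; pose N' := map_mx s N.
have D'unit : D' \in unitmx by rewrite map_unitmx.
have ND : N *m D = D *m N.
  rewrite /N /D !(mulmxBl, mulmxBr, mulmxDl, mulmxDr) (scalar_mxC a A).
  move: (A *m A) (a%:M *m A) (a%:M *m a%:M) => u v w.
  by apply/matrixP => k l; rewrite !mxE; ring.
have XD : X *m D = j *: N by rewrite /X -scalemxAl mulmxKV.
have DX : D *m X = j *: N by rewrite /X -scalemxAr mulmxA -ND mulmxK.
have D'X : D' *m map_mx s X = - j *: N' by rewrite -map_mxM DX map_mxZ sj.
have key : N' *m h *m D + D' *m h *m N = 2 *: (A' *m h *m A - h).
  rewrite /N' /D' map_mxD map_mxB map_scalar_mx -/A' /N /D.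
  rewrite !(mulmxDl, mulmxDr, mulmxBl, mulmxBr, mulNmx, mulmxN).
  rewrite !(mul_scalar_mx, mul_mx_scalar) -!scalemxAl !scalerA [a * _]mulrC saa scale1r.
  move: (A' *m h *m A) (A' *m h) (h *m A) => u v w.
  by apply/matrixP => k l; rewrite !mxE; ring.
have diff : D' *m (h *m X - map_mx s X *m h) *m D = (2 * j) *: (A' *m h *m A - h).
  rewrite (mulmxBr D') (mulmxBl _ _ D) [2 * j]mulrC -scalerA -key !mulmxA D'X -!scalemxAl.
  by rewrite -(mulmxA (D' *m h)) XD -scalemxAr scaleNr opprK -scalerDr addrC.
split=> [Ah|hX]; apply/eqP; rewrite -subr_eq0; apply/eqP.
  rewrite -(mulKmx D'unit (_ - _)) -(mulmxK Dunit (D' *m _)) diff Ah subrr.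
  by rewrite scaler0 mul0mx mulmx0.
move: diff; rewrite hX subrr mulmx0 mul0mx => /esym/eqP.
by rewrite scaler_eq0 mulf_eq0 (negPf two_neq0) (negPf j_neq0) /= => /eqP.
Qed.

(** * Scalars on the unit circle *)

Lemma exists_nonroot_image (F : idomainType) (p : {poly F}) (f : nat -> F) :
  injective f -> p != 0 -> exists n, ~~ root p (f n).
Proof.
move=> f_inj p_neq0; have := max_poly_roots p_neq0 (rs := map f (iota 0 (size p))).
rewrite (map_inj_uniq f_inj) iota_uniq size_map size_iota ltnn.
case: (altP allP) => [_ /(_ isT isT)//|/allPn[_ /mapP[n _ ->] nr] _].
by exists n.
Qed.

Lemma exists_imaginary (R : realType) :
  exists j : R[i], conjc j = - j /\ j != 0.
Proof.
exists 'i%C; split; last by rewrite eq_complex /= oner_eq0 andbF.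
by apply/eqP; rewrite eq_complex /= oppr0 !eqxx.
Qed.

(** The points (k + j) / (k - j), for k natural, are pairwise distinct, and conjugation inverts them
    since it swaps k + j and k - j. *)
Lemma exists_unimodular_nonroot (R : realType) (p : {poly R[i]}) :
  p != 0 -> exists a : R[i], conjc a * a = 1 /\ ~~ root p a.
Proof.
move=> p_neq0.
have [j [sj j_neq0]] := exists_imaginary R.
have j2_neq0 : 2 * j != 0 by rewrite mulf_neq0 ?pnatr_eq0.
have nB k : k%:R - j != 0.
  apply: contraNneq j2_neq0 => /subr0_eq kj.
  have := congr1 conjc kj; rewrite rmorph_nat sj kj => jN.
  by rewrite mulr_natl mulr2n {2}jN subrr.
have nD k : k%:R + j != 0.
  apply: contraNneq (nB k) => /(congr1 conjc).
  by rewrite rmorphD rmorph_nat rmorph0 /= sj => ->.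
have f_inj : injective (fun k : nat => (k%:R + j) / (k%:R - j)).
  move=> k l /eqP; rewrite eqr_div // => /eqP e.
  have : (2 * j) * (k%:R - l%:R) = 0.
    by apply: (etrans (y := (l%:R + j) * (k%:R - j) - (k%:R + j) * (l%:R - j)));
      [ring | rewrite e subrr].
  move/eqP; rewrite mulf_eq0 (negPf j2_neq0) /= subr_eq0 eqr_nat.
  by move/eqP.
have [k kP] := exists_nonroot_image _ _ _ f_inj p_neq0.
exists ((k%:R + j) / (k%:R - j)); split=> //.
rewrite rmorphM fmorphV rmorphB rmorphD !rmorph_nat /= sj opprK mulf_div [X in X / _]mulrC.
by rewrite divff // mulf_neq0.
Qed.

(** For any n-th root c of x, c times its conjugate is a nonnegative real whose n-th power is 1. *)
Lemma unimodular_root (R : realType) (n : nat) (x : R[i]) :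
  (0 < n)%N -> x * conjc x = 1 -> exists c : R[i], c ^+ n = x /\ c * conjc c = 1.
Proof.
move=> n_gt0 xx; exists (n.-root x); rewrite rootCK //; split=> //.
set c := n.-root x.
have cc_ge0 : 0 <= c * conjc c.
  case: c => u v; rewrite lecE /= mulrN mulrC addNr eqxx /= mulrN opprK.
  by rewrite addr_ge0 // -expr2 sqr_ge0.
apply/eqP; rewrite -(pexpr_eq1 n_gt0 cc_ge0) exprMn -rmorphXn /= rootCK //.
by rewrite xx.
Qed.

(** * From a c-symmetry to an involutory one *)

Theorem theorem1p2 (R : realType) (n : nat) (A : 'M[R[i]]_n) :
  (1 <= n)%N -> inSL A -> (c_reversible A <-> strongly_c_reversible A).
Proof.
case: n A => // n A _ detA; split=> [[h [deth hA]]|[h [deth hA _]]]; last by exists h.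
have unit1 (M : 'M[R[i]]_n.+1) : \det M = 1 -> M \in unitmx.
  by move=> detM; rewrite unitmxE detM unitr1.
have Aunit := unit1 _ detA; have hunit := unit1 _ deth.
have A'unit : mconj A \in unitmx by rewrite map_unitmx.
have AhA : mconj A *m h *m A = h.
  by rewrite -mulmxA -[h *m A](mulmxKV hunit) hA mulmxA mulmxV // mul1mx.
have [j [sj j_neq0]] := exists_imaginary R.
have two_neq0 : 2 != 0 :> R[i] by rewrite pnatr_eq0.
have [a [aa a_nonroot]] := exists_unimodular_nonroot _ _ (monic_neq0 (char_poly_monic A)).
have Aa_unit : A - a%:M \in unitmx.
  by rewrite -row_free_unit -kermx_eq0 -[_ == 0]negbK -/(eigenvalue A a) eigenvalue_root_char.
have cayley k := cayley_intertwine _ (@conjc R) _ A k a j two_neq0 j_neq0 sj aa Aa_unit.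
set X := j *: _ in cayley.
have hX := (cayley h).1 AhA.
(* p(X) is similar to p(conj X), which is the conjugate of (conj p)(X). *)
have rankX p : \rank (horner_mx X p) = \rank (horner_mx X (map_poly conjc p)).
  rewrite -[RHS](mxrank_map conjc) map_horner_mx.
  have -> : map_poly conjc (map_poly conjc p) = p.
    by apply/polyP => k; rewrite !coef_map /= conjcK.
  have hfull : row_full h by rewrite row_full_unit.
  have hfree : row_free h by rewrite row_free_unit.
  rewrite -(eqmxMfull (horner_mx X p) hfull) (horner_mx_intertwine _ _ _ _ _ _ _ hX).
  by rewrite mxrankMfree.
have [m [B [Z [Bfree Bfull sZ BX]]]] := similar_to_fixed _ _ _ _ rankX.
have [K [KK KX]] := coninvolution_of_fixed _ _ _ _ _ _ _ (@conjcK R) Bfree Bfull sZ BX.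
have AKA := (cayley K).2 KX.
have detKK : \det K * conjc (\det K) = 1 by rewrite -det_map_mx -det_mulmx KK det1.
(* det K is unimodular, so c can be an (n+1)-th root of its conjugate, which gives c K determinant
   1. As c is unimodular too, scaling by it keeps c K coninvolutory. *)
have [|c [cn cc]] := unimodular_root R n.+1 (conjc (\det K)) isT.
  by rewrite conjcK mulrC.
have detcK : \det (c *: K) = 1 by rewrite detZ cn mulrC.
exists (c *: K); split=> //.
  have cKunit := unit1 _ detcK.
  apply: (can_inj (mulKmx A'unit)); rewrite mulmxV // !mulmxA.
  by rewrite -scalemxAr -(scalemxAl c) AKA mulmxV.
rewrite /mconj map_mxZ -scalemxAl -scalemxAr scalerA cc scale1r.
exact: KK.
Qed.
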